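(* Let $(E,\rho)$ be a Polish space with Borel $\sigma$-algebra $\mathcal{B}(E)$, and let $P_t$ be the semigroup of a time-homogeneous Markov process on $E$. Let $p>1$, $\kappa>0$ and $\alpha\in\left(\frac{\kappa}{\kappa+1},1\right)$ be fixed. Suppose that $P_t$ satisfies the Harnack inequality $$(P_tf(x))^p\le \exp\left(H(x,y)(\varepsilon+t^{-\kappa})\right)P_tf^p(y),\qquad x,y\in E,\ f\in\mathcal{B}_b^+(E),\ t>0,$$ for some positive measurable function $H$ on $E\times E$ and a constant $\varepsilon\ge 0$. Then there exists a constant $c>0$ depending on $\alpha$ and $\kappa$ such that $$(P_t^\alpha f(x))^p\le e^{\varepsilon H(x,y)}\left(1+\left[\exp\left(\left(\frac{cH(x,y)}{(p-1)t^{\kappa/\alpha}}\right)^{1/(1-(\alpha^{-1}-1)\kappa)}\right)-1\right]^{1-(\alpha^{-1}-1)\kappa}\right)^{p-1}P_t^\alpha f^p(y)$$ $$\le 2^{p-1}\exp\left(\varepsilon H(x,y)+C_{p,\kappa,\alpha}\left(\frac{H(x,y)}{t^{\kappa/\alpha}}\right)^{1/(1-(\alpha^{-1}-1)\kappa)}\right)P_t^\alpha f^p(y),\qquad t>0,\ x,y\in E,$$ holds for all $f\in\mathcal{B}_b^+(E)$, where $$C_{p,\kappa,\alpha}=\frac{(1-(\alpha^{-1}-1)\kappa)\,c^{1/(1-(\alpha^{-1}-1)\kappa)}}{(p-1)^{(\alpha^{-1}-1)\kappa/(1-(\alpha^{-1}-1)\kappa)}}.$$ Consequently, if $P_t$ has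 an invariant probability measure $\mu$, then, for $t>0$: (i) for any $p,q>1$, $$\frac{\|P_t^\alpha\|_{p\to q}}{2^{(p-1)/p}}\le\left(\int_E\frac{\mu(dx)}{\left(\int_E\exp\left[-\varepsilon H(x,y)-C_{p,\kappa,\alpha}\left(\frac{H(x,y)}{t^{\kappa/\alpha}}\right)^{1/(1-(\alpha^{-1}-1)\kappa)}\right]\mu(dy)\right)^{q/p}}\right)^{1/q};$$ (ii) if $P_t^\alpha$ has a transition density $p_t^\alpha(x,y)$ with respect to $\mu$, then for any $x\in\operatorname{supp}(\mu)$, $$\int_E p_t^\alpha(x,y)^2\,\mu(dy)\le 2\left(\int_E\exp\left(-\varepsilon H(x,y)-C_{p,\kappa,\alpha}\left(\frac{H(x,y)}{t^{\kappa/\alpha}}\right)^{1/(1-(\alpha^{-1}-1)\kappa)}\right)\mu(dy)\right)^{-1}.$$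
   Context: $\mathcal{B}_b^+(E)$ is the class of all bounded positive measurable functions on $E$. For $\alpha\in(0,1]$, $\{\mu_t^\alpha\}_{t\ge0}$ denotes the convolution semigroup of probability measures on $[0,\infty)$ (that is, $\mu^\alpha_{t+s}=\mu^\alpha_t*\mu^\alpha_s$ for $s,t\ge0$, and $\mu_t^\alpha\to\mu_0^\alpha:=\delta_0$ weakly as $t\to0$) with Laplace transform $$\int_0^\infty e^{-xs}\mu_t^\alpha(ds)=e^{-tx^\alpha},\qquad x\ge0,\ t\ge0.$$ The subordinated semigroup is $P_t^\alpha:=\int_0^\infty P_s\,\mu_t^\alpha(ds)$, $t\ge0$. $P_tf^p$ means $P_t(f^p)$, and likewise for $P_t^\alpha f^p$. $\|P_t^\alpha\|_{p\to q}$ is the operator norm of $P_t^\alpha$ from $L^p(E;\mu)$ to $L^q(E;\mu)$. A transition density of $P_t^\alpha$ with respect to $\mu$ is a function $p_t^\alpha(x,y)$ with $P_t^\alpha f(x)=\int_E p_t^\alpha(x,y)f(y)\,\mu(dy)$.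
   Formalization: Part (ii), the bound on the integral of the squared transition density, is stated only for 1 < p ≤ 2, because with the fixed exponent p > 2 it is false in general; everything else is stated for all p > 1. *)

(* Defs.v *)
From HB Require Import structures.
From mathcomp Require Import all_boot all_order all_algebra.
From mathcomp Require Import all_classical all_reals all_analysis.
From mathcomp Require Import measurable_realfun.

Set Implicit Arguments.
Unset Strict Implicit.
Unset Printing Implicit Defensive.

Import Order.TTheory GRing.Theory Num.Theory.
Import numFieldNormedType.Exports.

Local Open Scope classical_set_scope.
Local Open Scope ring_scope.

HB.mixin Record isSeparable T & Topological T := {
  separable_subproof : exists2 D : set T, countable D & dense D
}.

(* A Polish space (E, rho), with its complete metric rho = mdist.  Being
   pointed (nonempty) is required by the library's measurable types. *)
#[short(type="polishType")]
HB.structure Definition Polish (R : realType) :=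
  {T of Complete T & Metric R T & Pointed T & isSeparable T}.

Notation borel E := (g_sigma_algebraType (@open E)).

Section Semigroups.
Context {R : realType} {E : polishType R}.
Implicit Types (P : R -> R.-pker (borel E) ~> (borel E))
  (m : R -> probability R R) (mu : probability (borel E) R)
  (H : borel E -> borel E -> R).

(* Only the kernels [P t] with [0 <= t] are meaningful.  Joint measurability
   of the transition function is what makes the subordinated semigroup
   well defined. *)
Record markov_semigroup P : Prop := {
  markov_semigroup0 : forall x (A : set (borel E)), measurable A ->
    P 0 x A = \d_x A;
  markov_semigroupD : forall (s t : R) x (A : set (borel E)),
    0 <= s -> 0 <= t ->
    measurable A -> P (s + t) x A = (\int[P s x]_y P t y A)%E;
  markov_semigroup_measurable : forall A : set (borel E), measurable A ->
    measurable_fun ([set s : R | 0 <= s] `*` setT)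
      (fun z : R * borel E => P z.1 z.2 A)
}.

Definition semigroup_op P (t : R) (f : borel E -> \bar R) (x : borel E)
    : \bar R := (\int[P t x]_y f y)%E.

(* Probability measures on [0, +oo[ are represented by probability measures
   on the real line giving no mass to the negative numbers. *)
Record stable_subordinator (alpha : R) m : Prop := {
  stable_supp : forall t : R, 0 <= t -> m t [set s : R | s < 0] = 0%E;
  stable0 : forall A : set R, measurable A -> m 0 A = \d_(0 : R) A;
  stable_convolution : forall (s t : R) (A : set R), 0 <= s -> 0 <= t ->
    measurable A -> m (s + t) A = ((m s \x m t) [set z | A (z.1 + z.2)%R])%E;
  stable_weak_cvg : forall f : R -> R, continuous f ->
    (exists M : R, forall s, `|f s| <= M) ->
    (\int[m t]_s (f s)%:E)%E @[t --> 0^'+] --> (f 0)%:E;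
  stable_laplace : forall x t : R, 0 <= x -> 0 <= t ->
    (\int[m t]_(s in `[0%R, +oo[) (expR (- (x * s)))%:E)%E =
    (expR (- (t * x `^ alpha)))%:E
}.

Definition subordinated P m (t : R) (f : borel E -> \bar R) (x : borel E)
    : \bar R := (\int[m t]_(s in `[0%R, +oo[) semigroup_op P s f x)%E.

(* The class B_b^+(E); "positive" means nonnegative. *)
Definition bounded_pos_meas (f : borel E -> R) : Prop :=
  [/\ measurable_fun setT f, forall x, 0 <= f x &
      exists M : R, forall x, f x <= M].

Definition harnack (kappa eps p : R) H P : Prop :=
  forall x y (f : borel E -> R) (t : R), bounded_pos_meas f -> 0 < t ->
  (semigroup_op P t (EFin \o f) x `^ p <=
   (expR (H x y * (eps + t `^ (- kappa))))%:E *
     semigroup_op P t (fun z => (f z `^ p)%:E) y)%E.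

Definition invariant_measure P mu : Prop :=
  forall (t : R) (A : set (borel E)), 0 <= t -> measurable A ->
  (\int[mu]_x P t x A)%E = mu A.

(* Operator norm L^p(mu) -> L^q(mu), equal to +oo when T is unbounded. *)
Definition Lpq_norm mu (p q : R)
    (T : (borel E -> \bar R) -> borel E -> \bar R) : \bar R :=
  ereal_sup [set 'N[mu]_(q%:E) [T (EFin \o f)]%E |
    f in [set f : borel E -> R |
      f \in Lfun mu p%:E /\ ('N[mu]_(p%:E) [EFin \o f] <= 1)%E]].

Definition transition_density mu
    (T : (borel E -> \bar R) -> borel E -> \bar R)
    (d : borel E -> borel E -> R) : Prop :=
  (forall x, measurable_fun setT (d x)) /\
  (forall (f : borel E -> R) x, bounded_pos_meas f ->
    T (EFin \o f) x = (\int[mu]_y (d x y * f y)%:E)%E).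

Definition measure_supp mu : set E :=
  [set x | forall U : set E, open U -> U x -> (0 < mu U)%E].

End Semigroups.

Section Constants.
Context {R : realType}.
Implicit Types c p kappa alpha : R.

(* Exponent 1 - (1/alpha - 1) kappa; it is positive when
   alpha > kappa / (kappa + 1). *)
Definition Hexp kappa alpha : R := 1 - (alpha^-1 - 1) * kappa.

Definition Cpka c p kappa alpha : R :=
  Hexp kappa alpha * c `^ (1 / Hexp kappa alpha) /
  (p - 1) `^ ((alpha^-1 - 1) * kappa / Hexp kappa alpha).

End Constants.

(* Main.v *)
(* Averaging the Harnack inequality over the subordinator and applying Hoelder's
   inequality in the time variable reduces the first claim to the bound
     E exp(lambda S^(-kappa)) <= 1 + (exp((c lambda t^(-kappa/alpha))^(1/r)) - 1)^r
   for S of law mu_t^alpha, where r = Hexp kappa alpha.  Instead of computing the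
   moments of S^(-kappa) with Gamma functions, put
   y = (S t^(-1/alpha))^(-alpha/(1-alpha)) and L = lambda t^(-kappa/alpha), so that
   lambda S^(-kappa) = L y^(1-r).  Young's inequality then bounds exp(L y^(1-r)) by
   1 + C2 L exp(C1 L^(1/r)) exp(delta y), and for small delta the expectation of
   exp(delta y) is finite because exp(delta y) is dominated by a series of
   exponentials exp(-x_n S), whose expectations are given by the Laplace transform
   and decay geometrically.

   Integrating the resulting inequality in y against the invariant measure gives
   (i); for (ii) it is tested on truncations of the density. *)
Require Import Defs.
From mathcomp Require Import all_boot all_order all_algebra.
From mathcomp Require Import all_classical all_reals all_analysis.
From mathcomp Require Import measurable_realfun.
From mathcomp Require Import ring lra.

Import Order.TTheory GRing.Theory Num.Theory.
Import numFieldNormedType.Exports.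
Local Open Scope classical_set_scope.
Local Open Scope ring_scope.

(** * Elementary inequalities between powers and exponentials *)

Section real_bounds.
Context {R : realType}.
Implicit Types (x y L delta r a : R).

(** A weighted geometric mean is at most the larger of its two arguments. *)
Lemma mul_powR_le_add x y r : 0 <= x -> 0 <= y -> 0 <= r -> r <= 1 ->
  x `^ r * y `^ (1 - r) <= x + y.
Proof.
move=> x0 y0 r0 r1.
have r10 : 0 <= 1 - r by rewrite subr_ge0.
have E z : 0 <= z -> z `^ r * z `^ (1 - r) = z.
  move=> z0; rewrite -powRD; first by rewrite subrKC powRr1.
  by rewrite subrKC oner_eq0.
have [xy|/ltW yx] := leP x y.
- apply: (@le_trans _ _ y); last by rewrite lerDr.
  rewrite -[leRHS]E// ler_wpM2r ?powR_ge0//.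
  by apply: ge0_ler_powR; rewrite ?nnegrE.
- apply: (@le_trans _ _ x); last by rewrite lerDl.
  rewrite -[leRHS]E// ler_wpM2l ?powR_ge0//.
  by apply: ge0_ler_powR; rewrite ?nnegrE.
Qed.

(** This is [mul_powR_le_add] for the two summands on the right: the powers of [delta] cancel in the
    geometric mean. It makes the coefficient of [y] arbitrarily small. *)
Lemma mul_powR_le_expR_rate L y delta r : 0 <= L -> 0 <= y -> 0 < delta ->
  0 < r -> r < 1 ->
  L * y `^ (1 - r) <= L `^ (1 / r) * delta `^ (- (1 - r) / r) + delta * y.
Proof.
move=> L0 y0 d0 r0 r1.
have rn0 : r != 0 by rewrite gt_eqF.
apply: le_trans (@mul_powR_le_add _ _ r _ _ (ltW r0) (ltW r1)); last 2 first.
- by rewrite mulr_ge0// powR_ge0.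
- by rewrite mulr_ge0// ltW.
rewrite !powRM ?powR_ge0 ?(ltW d0)// -!powRrM.
rewrite divfK// divfK// powRr1//.
rewrite mulrACA -!mulrA.
by rewrite [delta `^ _ * _ in leRHS]mulrCA (mulrA (delta `^ _))
  -powRD ?addNr ?powRr0 ?mul1r ?(gt_eqF d0) ?implybT.
Qed.

(** The bound must tend to 1 as L tends to 0, so a factor L is split off first by e^z <= 1 + z e^z.
    Half of [delta] then absorbs the factor y^(1-r), and the other half pays for Young's inequality
    in the exponent. *)
Lemma expR_powR_bound delta r : 0 < delta -> 0 < r -> r < 1 ->
  exists C1 C2 : R, [/\ 0 < C1, 0 < C2 &
  forall L y, 0 <= L -> 0 <= y ->
    expR (L * y `^ (1 - r)) <=
    1 + C2 * L * expR (C1 * L `^ (1 / r)) * expR (delta * y)].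
Proof.
move=> d0 r0 r1; pose h := delta / 2.
have h0 : 0 < h by rewrite divr_gt0.
exists (h `^ (- (1 - r) / r)), (1 + h^-1); split.
- exact: powR_gt0.
- by rewrite addr_gt0 ?invr_gt0.
move=> L y L0 y0; set v := y `^ (1 - r); have v0 : 0 <= v := powR_ge0 _ _.
have vE : v <= (1 + h^-1) * expR (h * y).
  have : v <= 1 + y.
    have := @mul_powR_le_add 1 y r ler01 y0 (ltW r0) (ltW r1).
    by rewrite powR1 mul1r.
  move=> /le_trans; apply.
  rewrite mulrDl mul1r lerD//.
    by rewrite -expR0 ler_expR mulr_ge0// ltW.
  rewrite mulrC ler_pdivlMr// mulrC.
  by apply: le_trans (expR_ge1Dx _); rewrite lerDr.
have LvE := @mul_powR_le_expR_rate L y h r L0 y0 h0 r0 r1.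
(* Multiply 1 - z <= e^(-z) by e^z, with z = L v. *)
have e1 : expR (L * v) <= 1 + L * v * expR (L * v).
  have := @expR_ge1Dx _ (- (L * v)).
  rewrite expRN -(ler_pM2r (expR_gt0 (L * v))) mulVf ?gt_eqF ?expR_gt0//.
  by rewrite mulrDl mul1r mulNr lerBlDr.
apply: (le_trans e1); rewrite lerD2l.
have -> : delta * y = h * y + h * y by rewrite /h; field.
rewrite expRD.
have eLv : expR (L * v) <=
    expR (h `^ (- (1 - r) / r) * L `^ (1 / r)) * expR (h * y).
  by rewrite -expRD ler_expR mulrC [X in _ <= X + _]mulrC mulrC.
apply: (@le_trans _ _ (L * ((1 + h^-1) * expR (h * y)) *
   (expR (h `^ (- (1 - r) / r) * L `^ (1 / r)) * expR (h * y)))).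
  by apply: ler_pM; rewrite ?mulr_ge0 ?expR_ge0 ?ler_wpM2l.
by rewrite le_eqVlt; apply/orP; left; apply/eqP; ring.
Qed.

(** With u = (cL)^(1/r), both sides are compared with ((u/2) e^(u/2))^r. The two conditions on c
    bound the prefactor by (u/2)^r and the exponent by r u/2; on the other side (u/2) e^(u/2) <= e^u
    - 1, because e^(u/2) - u/2 >= 1. *)
Lemma linear_expR_le_powR (c C1 C2 L r : R) : 0 < r -> r < 1 ->
  0 <= C2 -> 0 <= L -> 2 * C2 <= c -> 2 * C1 <= r * c `^ (1 / r) ->
  C2 * L * expR (C1 * L `^ (1 / r)) <= (expR ((c * L) `^ (1 / r)) - 1) `^ r.
Proof.
move=> r0 r1 C20 L0 C2c C1c.
have c0 : 0 <= c by apply: le_trans C2c; rewrite mulr_ge0.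
set u := (c * L) `^ (1 / r).
have u0 : 0 <= u := powR_ge0 _ _.
have rn0 : r != 0 by rewrite gt_eqF.
have cL0 : 0 <= c * L by rewrite mulr_ge0.
have ur : u `^ r = c * L by rewrite /u -powRrM div1r mulVf// powRr1.
have u20 : 0 <= u / 2 by rewrite divr_ge0.
apply: (@le_trans _ _ ((u / 2 * expR (u / 2)) `^ r)).
  rewrite powRM ?expR_ge0// powRM ?invr_ge0// ur -expRM.
  apply: ler_pM; rewrite ?expR_ge0// ?mulr_ge0//.
    rewrite mulrAC ler_wpM2r//.
    (* Since r < 1, 1/2 <= (1/2)^r. *)
    apply: (@le_trans _ _ (c / 2)); first by rewrite ler_pdivlMr// mulrC.
    rewrite ler_wpM2l//; apply: ger1_powR; last exact: ltW.
    by rewrite invr_gt0 ltr0n/= invf_le1// ler1n.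
  rewrite ler_expR /u powRM//.
  by have := powR_ge0 L (1 / r); nra.
apply: ge0_ler_powR; rewrite ?nnegrE ?(ltW r0)//.
- by rewrite mulr_ge0// expR_ge0.
- by rewrite subr_ge0 -expR0 ler_expR.
- have -> : expR u = expR (u / 2) * expR (u / 2) by rewrite -expRD -splitr.
  have := expR_ge1Dx (u / 2); have := expR_gt0 (u / 2).
  set e := expR _; nra.
Qed.

End real_bounds.

(** * Exponential moment of a negative power of a stable variable *)

Section stable_moment.
Context {R : realType}.
Local Notation halfline := (`[0%R, +oo[%classic : set R).

(* n is the integer part of y = z^(-alpha/(1-alpha)); on y >= n one has
   n^(1/alpha) z <= n, so the second factor beats e^(-A n). *)
Lemma expR_le_laplace_term (A alpha delta z : R) :
  0 < alpha -> alpha < 1 -> 0 <= A -> 0 <= delta -> 0 <= z ->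
  exists n : nat, expR (delta * z `^ (- (alpha / (1 - alpha)))) <=
    expR (delta * n.+1%:R + A * n%:R) * expR (- (A * n%:R `^ alpha^-1 * z)).
Proof.
move=> al0 al1 A0 d0 z0; set y := z `^ _.
have y0 : 0 <= y := powR_ge0 _ _.
exists (Num.truncn y); set n := Num.truncn y.
have ny : n%:R <= y by rewrite truncn_le.
have yn : y < n.+1%:R by have := truncn_itv y0 => /andP[].
rewrite -expRD ler_expR -addrA; apply: ler_wpDr; last first.
  by rewrite ler_wpM2l// ltW.
rewrite subr_ge0 -mulrA ler_wpM2l//.
have [->|n0] := eqVneq n 0%N; first by rewrite powR0 ?mul0r// invr_neq0 ?gt_eqF.
have n_gt0 : 0 < n%:R :> R by rewrite ltr0n lt0n.
have ypos : 0 < y := lt_le_trans n_gt0 ny.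
(* Zero raised to a nonzero power is 0 by convention, so [y] vanishes at z = 0 and y > 0 forces z >
   0. *)
have zpos : 0 < z.
  rewrite lt_neqAle eq_sym z0 andbT; apply: contraTneq ypos => z_eq0.
  rewrite /y z_eq0 powR0 ?ltxx// oppr_eq0 gt_eqF// divr_gt0// subr_gt0//.
have zE : z = y `^ (1 - alpha^-1).
  rewrite /y -powRrM [X in _ `^ X](_ : _ = 1) ?powRr1//.
  by field; rewrite gt_eqF//= subr_eq0 gt_eqF.
have -> : alpha^-1 = 1 + (alpha^-1 - 1) by rewrite subrKC.
rewrite powRD ?(gt_eqF n_gt0) ?implybT// powRr1 ?(ltW n_gt0)// -mulrA.
rewrite -[leRHS]mulr1 ler_wpM2l ?(ltW n_gt0)//.
have -> : z = (y `^ (alpha^-1 - 1))^-1 by rewrite zE -powRN opprB.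
rewrite ler_pdivrMr ?powR_gt0// mul1r ge0_ler_powR ?nnegrE ?(ltW n_gt0)//.
by rewrite subr_ge0 invf_ge1// ltW.
Qed.

Variables (alpha : R) (al0 : 0 < alpha) (al1 : alpha < 1).

(* Any A in ]0, 1[ works: alpha < 1 gives A^alpha > A. *)
Let A : R := 1 / 2.
(** Half of the gap between A^alpha and A: the gap is the decay rate of the Laplace terms, one half
    is spent on the exponential moment and the other keeps the series geometric. *)
Definition stable_rate : R := (A `^ alpha - A) / 2.

Lemma stable_rate_gt0 : 0 < stable_rate.
Proof.
have A01 : 0 < A < 1 by rewrite /A; lra.
have [A_gt0 _] := andP A01.
rewrite /stable_rate divr_gt0// subr_gt0 -[ltLHS](powRr1 (ltW A_gt0)).
by rewrite /powR gt_eqF// ltr_expR ltr_nM2r// ln_lt0.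
Qed.

Lemma ge0_geometric_nneseries (a q : R) : 0 <= a -> 0 <= q -> q < 1 ->
  (\sum_(n <oo) (a * q ^+ n)%:E)%E = (a / (1 - q))%:E.
Proof.
move=> a0 q0 q1; apply/cvg_lim => //.
have -> : (fun n => \sum_(0 <= i < n) (a * q ^+ i)%:E)%E =
    EFin \o series (geometric a q).
  by apply/funext => n /=; rewrite sumEFin.
apply/cvg_EFin; first by near=> n.
apply: cvg_geometric_series; rewrite ger0_norm//.
Unshelve. all: by end_near. Qed.

Variables (mu : {measure set R -> \bar R}) (t : R) (t0 : 0 < t).
Hypothesis laplace : forall x, 0 <= x ->
  (\int[mu]_(s in halfline) (expR (- (x * s)))%:E)%E =
  (expR (- (t * x `^ alpha)))%:E.

(** At each s the integrand is below one term of the series of the [g n], hence below its sum. The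
    Laplace transform at x = A n^(1/alpha) t^(-1/alpha), where t x^alpha = A^alpha n, evaluates the
    n-th integral as e^d e^(-dn); the scaling by t makes the bound independent of t. *)
Lemma stable_exp_moment :
  (\int[mu]_(s in halfline)
     (expR (stable_rate *
        (s * t `^ (- alpha^-1)) `^ (- (alpha / (1 - alpha)))))%:E
   <= (expR stable_rate / (1 - expR (- stable_rate)))%:E)%E.
Proof.
set d := stable_rate; have d0 : 0 < d := stable_rate_gt0.
have A0 : 0 < A by rewrite /A divr_gt0.
pose tt := t `^ (- alpha^-1).
have tt0 : 0 < tt := powR_gt0 _ t0.
pose g (n : nat) (s : R) : R :=
  expR (d * n.+1%:R + A * n%:R) * expR (- (A * n%:R `^ alpha^-1 * tt * s)).
have mg n : measurable_fun halfline (EFin \o g n).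
  apply/measurable_EFinP; apply: measurable_funM => //.
  by do 2 apply: measurableT_comp => //.
have g0 n s : 0 <= g n s by rewrite mulr_ge0// expR_ge0.
have intg n : (\int[mu]_(s in halfline) (g n s)%:E)%E =
    (expR d * expR (- d) ^+ n)%:E.
  rewrite /g; under eq_integral do rewrite EFinM.
  rewrite ge0_integralZl ?lee_fin ?expR_ge0//; last first.
    by apply/measurable_EFinP; do 2 apply: measurableT_comp => //.
  rewrite laplace ?mulr_ge0 ?powR_ge0 ?(ltW A0) ?(ltW tt0)//.
  rewrite -EFinM -expRD -expRM_natr -expRD; congr (expR _)%:E.
  rewrite powRM ?mulr_ge0 ?powR_ge0 ?(ltW A0) ?(ltW tt0)//.
  rewrite powRM ?powR_ge0 ?(ltW A0)// /tt -!powRrM mulNr mulVf ?gt_eqF//.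
  rewrite powRr1// powR_inv1 ?(ltW t0)//.
  rewrite [t * _](_ : _ = A `^ alpha * n%:R); last first.
    by rewrite mulrC divfK// gt_eqF.
  have -> : A `^ alpha = 2 * d + A by rewrite /d /stable_rate; field.
  rewrite -(natr1 n); ring.
have mf : measurable_fun halfline (fun s : R =>
    (expR (d * (s * tt) `^ (- (alpha / (1 - alpha)))))%:E).
  apply/measurable_EFinP; apply: measurableT_comp => //.
  apply: measurable_funM => //; apply: (measurableT_comp (measurable_powR _)).
  exact: measurable_funM.
apply: (@le_trans _ _ (\int[mu]_(s in halfline) \sum_(n <oo) (g n s)%:E)%E).
  apply: ge0_le_integral => //.
  - by apply: ge0_emeasurable_sum => n *; [rewrite lee_fin|exact: mg].
  - move=> s /=; rewrite in_itv/= andbT => s0.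
    (* The index n depends on s, which is why the whole series is needed as a majorant. *)
    have [n sn] := @expR_le_laplace_term A alpha d (s * tt) al0 al1 (ltW A0)
      (ltW d0) (mulr_ge0 s0 (ltW tt0)).
    apply: (@le_trans _ _ (g n s)%:E).
      by rewrite lee_fin /g -(mulrA _ tt) [tt * s]mulrC.
    rewrite (@nneseriesD1 _ _ n)//.
      by rewrite leeDl// nneseries_ge0// => k _ _; rewrite lee_fin.
    by move=> k _; rewrite lee_fin.
rewrite integral_nneseries//; last by move=> n s _; rewrite lee_fin.
under eq_eseriesr do rewrite intg.
rewrite ge0_geometric_nneseries ?expR_ge0//.
by rewrite -expR0 ltr_expR oppr_lt0.
Qed.

End stable_moment.

(** * Exponential moments of S^(-kappa) *)

Section inverse_moment.
Context {R : realType}.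
Variables (alpha kappa : R) (kappa0 : 0 < kappa)
  (alphak : kappa / (kappa + 1) < alpha) (al1 : alpha < 1).

Local Notation halfline := (`[0%R, +oo[%classic : set R).

Let al0 : 0 < alpha.
Proof. by apply: lt_trans alphak; rewrite divr_gt0// addr_gt0. Qed.

Lemma Hexp_lt1 : Hexp kappa alpha < 1.
Proof.
by rewrite /Hexp gtrDl oppr_lt0 mulr_gt0// subr_gt0 invf_gt1.
Qed.

Lemma Hexp_gt0 : 0 < Hexp kappa alpha.
Proof.
rewrite /Hexp subr_gt0; move: alphak; rewrite ltr_pdivrMr ?addr_gt0//.
rewrite mulrDr mulr1 -ltrBlDr => k1.
rewrite -(ltr_pM2l al0) mulrA mulrBr mulfV ?gt_eqF// mulr1; lra.
Qed.

(** The only input on the law is its Laplace transform, so [c] is built from alpha and kappa alone;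
    [p] and the function [H] will enter through [lambda]. *)
Lemma stable_inverse_moment : exists2 c : R, 0 < c &
  forall (mu : {measure set R -> \bar R}) (t lambda : R),
  0 < t -> 0 <= lambda ->
  (forall x, 0 <= x ->
   (\int[mu]_(s in `[0%R, +oo[) (expR (- (x * s)))%:E)%E =
   (expR (- (t * x `^ alpha)))%:E) ->
  (\int[mu]_(s in `[0%R, +oo[) (expR (lambda * s `^ (- kappa)))%:E <=
   (1 + (expR ((c * lambda / t `^ (kappa / alpha)) `^ (1 / Hexp kappa alpha))
        - 1) `^ Hexp kappa alpha)%:E)%E.
Proof.
set r := Hexp kappa alpha.
have r0 : 0 < r := Hexp_gt0; have r1 : r < 1 := Hexp_lt1.
have d0 := @stable_rate_gt0 R alpha al1; set d := stable_rate alpha in d0.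
have [C1 [C2 [C10 C20 bnd]]] := expR_powR_bound _ _ d0 r0 r1.
pose K := expR d / (1 - expR (- d)).
have K0 : 0 < K.
  by rewrite /K divr_gt0 ?expR_gt0// subr_gt0 -expR0 ltr_expR oppr_lt0.
(* The two summands provide the two conditions of [linear_expR_le_powR], with C2 K in the place of
   C2. *)
pose c := 2 * (C2 * K) + (2 * C1 / r) `^ r.
have c0 : 0 < c by rewrite /c ltr_wpDr ?powR_ge0// (mulr_gt0 _ (mulr_gt0 C20 K0)).
exists c => // mu t lambda t0 l0 laplace.
pose L := lambda / t `^ (kappa / alpha).
have L0 : 0 <= L by rewrite /L divr_ge0// powR_ge0.
pose y s := (s * t `^ (- alpha^-1)) `^ (- (alpha / (1 - alpha))).
(* Since 1 - r = kappa (1 - alpha) / alpha, the exponents of s multiply to -kappa. *)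
have lE s : 0 <= s -> lambda * s `^ (- kappa) = L * y s `^ (1 - r).
  move=> s0; rewrite /L /y -powRrM.
  have -> : - (alpha / (1 - alpha)) * (1 - r) = - kappa.
    rewrite /r /Hexp; field.
    by rewrite gt_eqF//= subr_eq0 gt_eqF.
  rewrite powRM ?powR_ge0// -powRrM mulNr mulrN opprK (mulrC _ kappa).
  by rewrite -mulrA (mulrCA _ (s `^ _)) mulVf ?mulr1// gt_eqF// powR_gt0.
have le s : 0 <= s -> expR (lambda * s `^ (- kappa)) <=
    1 + C2 * L * expR (C1 * L `^ (1 / r)) * expR (d * y s).
  by move=> s0; rewrite lE//; apply: bnd => //; exact: powR_ge0.
have my : measurable_fun halfline (fun s => expR (d * y s)).
  apply: measurableT_comp => //; apply: measurable_funM => //.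
  by apply: (measurableT_comp (measurable_powR _)); exact: measurable_funM.
(* The Laplace transform at 0 is the total mass; it accounts for the summand 1 of the bound. *)
have mass1 : mu halfline = 1%E.
  have := laplace 0 (lexx _); rewrite powR0 ?gt_eqF// mulr0 oppr0 expR0.
  by under eq_integral do rewrite mul0r oppr0 expR0; rewrite integral_cst// mul1e.
set B := C2 * L * expR (C1 * L `^ (1 / r)) in le.
have B0 : 0 <= B := mulr_ge0 (mulr_ge0 (ltW C20) L0) (expR_ge0 _).
apply: (@le_trans _ _ 
  (\int[mu]_(s in `[0%R, +oo[) (1 + (B * expR (d * y s))%:E))%E).
  apply: ge0_le_integral => //.
  - apply/measurable_EFinP; apply: measurableT_comp => //.
    by apply: measurable_funM => //; exact: (measurable_funTS (measurable_powR _)).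
  - apply/measurable_EFinP; apply: measurable_funD => //.
    exact: measurable_funM.
  - by move=> s /=; rewrite in_itv/= andbT => s0; rewrite -EFinD lee_fin le.
rewrite ge0_integralD//; last 2 first.
- by move=> s _; rewrite lee_fin mulr_ge0// expR_ge0.
- by apply/measurable_EFinP; exact: measurable_funM.
rewrite integral_cst// mul1e mass1 EFinD leeD2l//.
under eq_integral do rewrite EFinM.
rewrite ge0_integralZl//; last exact/measurable_EFinP.
apply: (@le_trans _ _ (B%:E * K%:E)%E).
  by rewrite lee_wpmul2l ?lee_fin//; exact: stable_exp_moment.
rewrite -EFinM lee_fin.
rewrite (_ : B * K = C2 * K * L * expR (C1 * L `^ (1 / r))); last first.
  by rewrite /B; ring.
rewrite -(mulrA c) -/L.
apply: linear_expR_le_powR => //.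
- by rewrite mulr_ge0// ltW.
- by rewrite /c lerDl powR_ge0.
- rewrite [leRHS]mulrC -ler_pdivrMr//.
  have CE : 2 * C1 / r = ((2 * C1 / r) `^ r) `^ (1 / r).
    rewrite -powRrM div1r mulfV ?gt_eqF// powRr1//.
    by rewrite divr_ge0 ?mulr_ge0// ltW.
  rewrite {}CE; apply: ge0_ler_powR; rewrite ?nnegrE ?powR_ge0 ?(ltW c0)//.
    by rewrite div1r invr_ge0 ltW.
  by rewrite /c lerDr (mulr_ge0 _ (mulr_ge0 (ltW C20) (ltW K0))).
Qed.

End inverse_moment.

(** * Monotonicity of integrals and Hoelder's inequality *)

Section integral_bounds.
Context d (T : measurableType d) (R : realType).
Implicit Types (mu : {measure set T -> \bar R}) (D : set T).

(** The integral of a nonnegative function is a supremum over the simple functions below it. This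
    form allows integrands in x, such as powers of an integral over y, to be compared without a
    measurability proof. *)
Lemma ge0_le_integral_nonmeasurable mu (f g : T -> \bar R) :
  (forall x, 0 <= f x)%E -> (forall x, f x <= g x)%E ->
  (\int[mu]_x f x <= \int[mu]_x g x)%E.
Proof.
move=> f0 fg; have g0 x : (0 <= g x)%E := le_trans (f0 x) (fg x).
rewrite !ge0_integralTE//; apply: ereal_sup_le => _ [h hf <-].
by exists h => //= x; exact: le_trans (hf x) (fg x).
Qed.

(** Write x and y as the geometric mean e^m times e^((1-a)D) and e^(-aD), and use e^z >= 1 + z for
    both: the linear terms cancel in the weighted sum. *)
Lemma amgm_powR (x y a : R) : 0 <= x -> 0 <= y -> 0 <= a -> a <= 1 ->
  x `^ a * y `^ (1 - a) <= a * x + (1 - a) * y.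
Proof.
move=> x0 y0 a0 a1.
have [->|an0] := eqVneq a 0.
  by rewrite subr0 powRr0 powRr1// mul0r add0r !mul1r.
have [->|an1] := eqVneq a 1.
  by rewrite subrr powRr0 powRr1// mul0r addr0 mulr1 mul1r.
have a1n0 : 1 - a != 0 by rewrite subr_eq0 eq_sym.
have [->|xn0] := eqVneq x 0.
  by rewrite powR0// mul0r mulr0 add0r mulr_ge0// subr_ge0.
have [->|yn0] := eqVneq y 0.
  by rewrite [0 `^ _]powR0// mulr0 mulr0 addr0 mulr_ge0.
have xp : 0 < x by rewrite lt_neqAle eq_sym xn0.
have yp : 0 < y by rewrite lt_neqAle eq_sym yn0.
rewrite /powR (negbTE xn0) (negbTE yn0) -expRD.
set D := ln x - ln y; set m := a * ln x + (1 - a) * ln y.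
have -> : x = expR m * expR ((1 - a) * D).
  by rewrite -expRD [X in expR X](_ : _ = ln x) ?lnK// /m /D; ring.
have -> : y = expR m * expR (- (a * D)).
  by rewrite -expRD [X in expR X](_ : _ = ln y) ?lnK// /m /D; ring.
have h1 := expR_ge1Dx ((1 - a) * D); have h2 := expR_ge1Dx (- (a * D)).
rewrite (mulrCA a) (mulrCA (1 - a)) -mulrDr ler_peMr ?expR_ge0//.
have := ler_wpM2l a0 h1; have : 0 <= 1 - a by rewrite subr_ge0.
move=> /ler_wpM2l/(_ _ _ h2); lra.
Qed.

(** Integrate [amgm_powR] applied to F/J and G/B; the weights a and 1 - a add up to 1. Taking
    positive upper bounds J and B instead of the integrals themselves avoids dividing by zero. *)
Lemma hoelder_weighted mu D (F G : T -> R) (a J B : R) : measurable D ->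
  measurable_fun D F -> measurable_fun D G ->
  (forall x, D x -> 0 <= F x) -> (forall x, D x -> 0 <= G x) ->
  0 <= a -> a <= 1 -> 0 < J -> 0 < B ->
  (\int[mu]_(x in D) (F x)%:E <= J%:E)%E ->
  (\int[mu]_(x in D) (G x)%:E <= B%:E)%E ->
  (\int[mu]_(x in D) (F x `^ a * G x `^ (1 - a))%:E <=
   (J `^ a * B `^ (1 - a))%:E)%E.
Proof.
move=> mD mF mG F0 G0 a0 a1 J0 B0 FJ GB.
have a10 : 0 <= 1 - a by rewrite subr_ge0.
set K := J `^ a * B `^ (1 - a).
have K0 : 0 <= K by rewrite mulr_ge0 ?powR_ge0.
have kF0 : 0 <= K * a / J by rewrite divr_ge0 ?(ltW J0)// mulr_ge0.
have kG0 : 0 <= K * (1 - a) / B by rewrite divr_ge0 ?(ltW B0)// mulr_ge0.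
apply: (@le_trans _ _ (\int[mu]_(x in D)
    ((K * a / J)%:E * (F x)%:E + (K * (1 - a) / B)%:E * (G x)%:E))%E).
  apply: ge0_le_integral => //.
  - by move=> x _; rewrite lee_fin mulr_ge0 ?powR_ge0.
  - apply/measurable_EFinP; apply: measurable_funM.
      exact: (measurableT_comp (measurable_powR _)).
    exact: (measurableT_comp (measurable_powR _)).
  - apply: emeasurable_funD; apply: measurable_funeM; exact/measurable_EFinP.
  - move=> x Dx; rewrite -!EFinM -EFinD lee_fin.
    have := @amgm_powR (F x / J) (G x / B) a _ _ a0 a1.
    have FJ0 : 0 <= F x / J by rewrite divr_ge0 ?F0// ltW.
    have GB0 : 0 <= G x / B by rewrite divr_ge0 ?G0// ltW.
    move=> /(_ FJ0 GB0) /(ler_wpM2l K0).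
    rewrite [in X in K * X <= _]powRM ?F0 ?invr_ge0 ?(ltW J0)//.
    rewrite [in X in K * X <= _]powRM ?G0 ?invr_ge0 ?(ltW B0)//.
    have -> : J^-1 `^ a = (J `^ a)^-1.
      by rewrite -powR_inv1 ?(ltW J0)// powRAC powR_inv1 ?powR_ge0.
    have -> : B^-1 `^ (1 - a) = (B `^ (1 - a))^-1.
      by rewrite -powR_inv1 ?(ltW B0)// powRAC powR_inv1 ?powR_ge0.
    rewrite [leLHS](_ : _ = F x `^ a * G x `^ (1 - a)); last first.
      rewrite /K; field; rewrite !gt_eqF ?powR_gt0//.
    congr (_ <= _); field; rewrite !gt_eqF//.
rewrite ge0_integralD//; last 4 first.
- by move=> x Dx; rewrite mule_ge0 ?lee_fin ?F0.
- by apply: measurable_funeM; exact/measurable_EFinP.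
- by move=> x Dx; rewrite mule_ge0 ?lee_fin ?G0.
- by apply: measurable_funeM; exact/measurable_EFinP.
rewrite ge0_integralZl//; last exact/measurable_EFinP.
rewrite ge0_integralZl//; last exact/measurable_EFinP.
apply: (@le_trans _ _ ((K * a / J)%:E * J%:E + (K * (1 - a) / B)%:E * B%:E)%E).
  by rewrite leeD// lee_wpmul2l.
rewrite -!EFinM -EFinD lee_fin !divfK ?gt_eqF//.
by rewrite -mulrDr subrKC mulr1.
Qed.

End integral_bounds.

(** * Invariance extended from sets to nonnegative functions *)

Section invariant_kernel.
Context d (T : measurableType d) (R : realType).

(** The iterated integral is the integral against the composition of [mu], viewed as a kernel from
    [unit], with [k]; by invariance this composition agrees with [mu] on measurable sets. *)
Lemma integral_invariant_kernel (mu : probability T R) (k : R.-pker T ~> T)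
    (g : T -> \bar R) :
  (forall A, measurable A -> \int[mu]_x k x A = mu A)%E ->
  (forall x, 0 <= g x)%E -> measurable_fun [set: T] g ->
  (\int[mu]_x \int[k x]_y g y = \int[mu]_y g y)%E.
Proof.
move=> inv g0 mg.
have mcst : measurable_fun [set: unit]
    (fun _ : unit => (mu : pprobability T R)).
  exact: measurable_cst.
have := @integral_kcomp _ _ _ _ _ _ _ (kprobability mcst)
  (kernel.kernel_snd k) tt g g0 mg.
rewrite /kprobability/= => <-.
apply: eq_measure_integral => A mA _.
exact: inv.
Qed.

End invariant_kernel.

(** * Measurability, mass and invariance of the subordinated semigroup *)

Section subordination.
Context {R : realType} {E : polishType R}.
Variables (P : R -> R.-pker (borel E) ~> (borel E)) (alpha : R)
  (m : R -> probability R R).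
Hypotheses (hP : markov_semigroup P) (hm : stable_subordinator alpha m)
  (alpha0 : 0 < alpha).
Implicit Types (f g : borel E -> \bar R).
Local Notation halfline := (`[0%R, +oo[%classic : set R).
Local Notation Pa := (subordinated P m).

(* The truncation at 0 discards the negative times, where P is unspecified. *)
Lemma measurable_semigroup_max g : (forall x, 0 <= g x)%E ->
  measurable_fun [set: borel E] g ->
  measurable_fun [set: R * borel E]
    (fun z : R * borel E => semigroup_op P (Num.max z.1 0) g z.2).
Proof.
move=> g0 mg.
apply: (@measurable_fun_integral_kernel _ _ (R * borel E)%type (borel E) R
  (fun z : R * borel E => P (Num.max z.1 0) z.2)) => // U mU.
apply: (@measurable_comp _ _ _ _ _ _ ([set s : R | 0 <= s] `*` setT)
  (fun z : R * borel E => P z.1 z.2 U) setT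
  (fun z : R * borel E => (Num.max z.1 0, z.2))).
- apply: measurableX => //.
  rewrite (_ : [set s : R | 0 <= s] = halfline)//.
  by apply/seteqP; split => s /=; rewrite in_itv/= andbT.
- move=> _ [z _ <-]; split => //=.
  by rewrite le_max lexx orbT.
- exact: markov_semigroup_measurable.
- apply: measurable_fun_pair; last exact: measurable_snd.
  by apply: measurable_maxr.
Qed.

Lemma measurable_semigroup_time g x : (forall x, 0 <= g x)%E ->
  measurable_fun [set: borel E] g ->
  measurable_fun halfline (fun s => semigroup_op P s g x).
Proof.
move=> g0 mg.
have := measurable_semigroup_max _ g0 mg.
move=> /(@measurable_fun_pair1 _ _ _ _ _ _ _ x)/(measurable_funS measurableT) mm.
apply: (@eq_measurable_fun _ _ (measurableTypeR R) (\bar R) halfline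
  (fun s : R => semigroup_op P (Num.max s 0) g x)).
  move=> s; rewrite inE/= in_itv/= andbT => s0.
  by rewrite max_l.
exact: mm.
Qed.

Lemma measurable_semigroup_time_signed g x :
  measurable_fun [set: borel E] g ->
  measurable_fun halfline (fun s => semigroup_op P s g x).
Proof.
move=> mg.
have -> : (fun s => semigroup_op P s g x) =
    (fun s => semigroup_op P s (g^\+)%E x - semigroup_op P s (g^\-)%E x)%E.
  by apply/funext => s; rewrite /semigroup_op integralE.
apply: emeasurable_funB; apply: measurable_semigroup_time => //.
- exact: measurable_funepos.
- exact: measurable_funeneg.
Qed.

Lemma semigroup_ge0 s g x : (forall x, 0 <= g x)%E ->
  (0 <= semigroup_op P s g x)%E.
Proof. by move=> g0; apply: integral_ge0. Qed.

Lemma subordinated_ge0 t g x : (forall x, 0 <= g x)%E -> (0 <= Pa t g x)%E.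
Proof. by move=> g0; apply: integral_ge0 => s _; exact: semigroup_ge0. Qed.

Lemma subordinator_laplace t : 0 <= t -> forall x, 0 <= x ->
  (\int[m t]_(s in halfline) (expR (- (x * s)))%:E)%E =
  (expR (- (t * x `^ alpha)))%:E.
Proof. by move=> t0 x x0; exact: (stable_laplace hm). Qed.

Lemma subordinator_mass t : 0 <= t -> m t halfline = 1%E.
Proof.
move=> t0; have := subordinator_laplace _ t0 0 (lexx _).
rewrite powR0 ?gt_eqF// mulr0 oppr0 expR0 => <-.
by under eq_integral do rewrite mul0r oppr0 expR0; rewrite integral_cst// mul1e.
Qed.

(** The atom at 0 is at most the Laplace transform at every x, which tends to 0 as x grows; x is
    chosen to make the transform e^(-u). The Harnack inequality is given at positive times only, so
    time 0 has to be negligible. *)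
Lemma subordinator_no_atom0 t : 0 < t -> m t [set 0] = 0%E.
Proof.
move=> t0; have m0 : (0 <= m t [set 0%R])%E by [].
have le u : 0 < u -> (m t [set 0%R] <= (expR (- u))%:E)%E.
  move=> u0; pose x := (u / t) `^ alpha^-1.
  have x0 : 0 <= x := powR_ge0 _ _.
  have := subordinator_laplace _ (ltW t0) _ x0.
  rewrite /x -powRrM mulVf ?gt_eqF// powRr1 ?(divr_ge0 (ltW u0) (ltW t0))//.
  rewrite (mulrC t) divfK ?gt_eqF//.
  move=> <-.
  apply: (@le_trans _ _ (\int[m t]_(s in [set 0%R]) (expR (- (x * s)))%:E)%E).
    rewrite (eq_integral (cst 1%E)); first by rewrite integral_cst// mul1e.
    by move=> s; rewrite inE/= => ->; rewrite mulr0 oppr0 expR0.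
  apply: ge0_subset_integral => //=.
  - apply/measurable_EFinP; apply: measurable_funTS.
    by do 2 apply: measurableT_comp => //.
  - by move=> s ->; rewrite /= in_itv/= lexx.
apply/eqP; rewrite eq_le m0 andbT.
apply/lee_addgt0Pr => e e0; rewrite add0e.
have [e1|e1] := leP 1 e.
  apply: le_trans (le 1 ltr01) _; rewrite lee_fin (le_trans _ e1)//.
apply: le_trans (le (- ln e) _) _; first by rewrite oppr_gt0 ln_lt0// e0.
by rewrite opprK lnK.
Qed.

Lemma le_subordinated t f g x : (forall x, 0 <= f x)%E ->
  measurable_fun [set: borel E] f -> measurable_fun [set: borel E] g ->
  (forall x, f x <= g x)%E -> (Pa t f x <= Pa t g x)%E.
Proof.
move=> f0 mf mg fg; have g0 y : (0 <= g y)%E := le_trans (f0 y) (fg y).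
apply: ge0_le_integral => //.
- by move=> s _; exact: semigroup_ge0.
- exact: measurable_semigroup_time.
- exact: measurable_semigroup_time.
- by move=> s _; apply: ge0_le_integral.
Qed.

Lemma subordinated_cst t (c : R) x : 0 <= t -> 0 <= c ->
  Pa t (cst c%:E) x = c%:E.
Proof.
move=> t0 c0; rewrite /subordinated /semigroup_op.
under eq_integral do rewrite integral_cst// prob_kernel mule1.
by rewrite integral_cst// [X in (_ * X)%E](subordinator_mass _ t0) mule1.
Qed.

Lemma abse_subordinated_le t (f : borel E -> R) x :
  measurable_fun [set: borel E] f ->
  (`|Pa t (EFin \o f) x| <= Pa t (fun y => `|f y|%:E) x)%E.
Proof.
move=> mf; have mef : measurable_fun [set: borel E] (EFin \o f).
  exact/measurable_EFinP.
have maf : measurable_fun [set: borel E] (fun y => `|f y|%:E).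
  by apply/measurable_EFinP; exact: measurableT_comp.
apply: le_trans (le_abse_integral _ _ _) _ => //.
  exact: measurable_semigroup_time_signed.
apply: ge0_le_integral => //.
- apply: measurableT_comp => //; exact: measurable_semigroup_time_signed.
- exact: measurable_semigroup_time.
- by move=> s _; exact: le_abse_integral.
Qed.

(** The integrand P_s g(x), cut off by an indicator at negative times: this version is jointly
    measurable on the whole product, as Tonelli's theorem requires. *)
Let patched g (z : borel E * R) : \bar R :=
  ((\1_halfline z.2)%:E * semigroup_op P (Num.max z.2 0%R) g z.1)%E.

Let measurable_patched g : (forall x, 0 <= g x)%E ->
  measurable_fun [set: borel E] g ->
  measurable_fun [set: borel E * R] (patched g).
Proof.
move=> g0 mg; apply: emeasurable_funM.
  apply/measurable_EFinP.
  by apply: (measurableT_comp (measurable_indic _)) => //.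
have := measurableT_comp (measurable_semigroup_max _ g0 mg)
  (@measurable_swap _ _ _ _).
by apply.
Qed.

Let subordinated_patched t g x : Pa t g x = (\int[m t]_s patched g (x, s))%E.
Proof.
rewrite /subordinated integral_mkcond; apply: eq_integral => s _.
rewrite /patched /= patchE indicE; case: ifPn => sH; last by rewrite mul0e.
rewrite mul1e max_l//; move: sH; rewrite inE/= in_itv/= andbT//.
Qed.

Let patched_ge0 g z : (forall x, 0 <= g x)%E -> (0 <= patched g z)%E.
Proof. by move=> g0; rewrite mule_ge0 ?lee_fin// semigroup_ge0. Qed.

Lemma measurable_subordinated t g : (forall x, 0 <= g x)%E ->
  measurable_fun [set: borel E] g ->
  measurable_fun [set: borel E] (Pa t g).
Proof.
move=> g0 mg; rewrite (_ : Pa t g = fun x => \int[m t]_s patched g (x, s))%E.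
  apply: (measurable_fun_fubini_tonelli_F (patched g)) => //.
  - exact: measurable_patched.
  - by move=> z; exact: patched_ge0.
by apply/funext => x; exact: subordinated_patched.
Qed.

(** Tonelli puts the space integral inside; at each time s >= 0 invariance under P_s makes it
    constant, and the subordinator has mass 1. *)
Lemma integral_subordinated (mu : probability (borel E) R) t g : 0 <= t ->
  invariant_measure P mu -> (forall x, 0 <= g x)%E ->
  measurable_fun [set: borel E] g ->
  (\int[mu]_x Pa t g x = \int[mu]_x g x)%E.
Proof.
move=> t0 inv g0 mg.
under eq_integral do rewrite subordinated_patched.
rewrite (fubini_tonelli (patched g))//; last 2 first.
- exact: measurable_patched.
- by move=> z; exact: patched_ge0.
transitivity (\int[m t]_(s in halfline) \int[mu]_x g x)%E; last first.
  by rewrite integral_cst// [X in (_ * X)%E](subordinator_mass _ t0) mule1.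
rewrite [RHS]integral_mkcond; apply: eq_integral => s _.
rewrite patchE /patched /=; case: ifPn => sH; last first.
  rewrite indicE (negbTE sH); under eq_integral do rewrite mul0e.
  by rewrite integral0.
rewrite indicE sH; under eq_integral do rewrite mul1e.
have s0 : 0 <= s by move: sH; rewrite inE/= in_itv/= andbT.
rewrite max_l//; apply: integral_invariant_kernel => // A mA.
exact: inv.
Qed.

(** Monotone convergence in both integrals carries a bound from bounded functions to unbounded
    ones. *)
Lemma subordinated_truncated_le t (g : borel E -> R) x (D : \bar R) :
  measurable_fun [set: borel E] g -> (forall y, 0 <= g y) ->
  (forall n : nat, Pa t (fun y => (Num.min (g y) n%:R)%:E) x <= D)%E ->
  (Pa t (EFin \o g) x <= D)%E.
Proof.
move=> mg g0 le.
pose gn n y := (Num.min (g y) n%:R)%:E : \bar R.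
have gn0 n y : (0 <= gn n y)%E by rewrite lee_fin le_min g0/=.
have mgn n : measurable_fun [set: borel E] (gn n).
  by apply/measurable_EFinP; exact: measurable_minr.
have gnD n k y : (n <= k)%N -> (gn n y <= gn k y)%E.
  move=> nk; rewrite lee_fin le_min ge_min lexx/= ge_min.
  by apply/orP; right; rewrite ler_nat.
(* Truncation at n has no effect once n exceeds g y, so the sequence is eventually constant. *)
have limg y : limn (gn ^~ y) = (g y)%:E.
  apply: lim_near_cst => //.
  exists (Num.truncn (g y)).+1 => // n /= yn.
  rewrite /gn min_l//; apply: le_trans (ltW (truncnS_gt _)) _.
  by rewrite ler_nat.
have -> : Pa t (EFin \o g) x = limn (fun n => Pa t (gn n) x).
  rewrite /subordinated -monotone_convergence//.
  - apply: eq_integral => s _; rewrite /semigroup_op -monotone_convergence//.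
    + by apply: eq_integral => y _; rewrite limg.
    + by move=> y _ n k nk; exact: gnD.
  - by move=> n; exact: measurable_semigroup_time.
  - by move=> n s _; exact: semigroup_ge0.
  - move=> s _ n k nk; apply: ge0_le_integral => // y _; exact: gnD.
apply: lime_le; last by apply: nearW => n; exact: le.
apply: ereal_nondecreasing_is_cvgn => n k nk.
by apply: le_subordinated => // y; exact: gnD.
Qed.

End subordination.

(** * Averaging the Harnack inequality over the subordinator *)

Section subordinated_harnack.
Context {R : realType} {E : polishType R}.
Variables (P : R -> R.-pker (borel E) ~> (borel E)) (alpha : R)
  (m : R -> probability R R).
Hypotheses (hP : markov_semigroup P) (hm : stable_subordinator alpha m)
  (alpha0 : 0 < alpha).
Local Notation halfline := (`[0%R, +oo[%classic : set R).
Local Notation Pa := (subordinated P m).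

Lemma semigroup_fin s (g : borel E -> R) x : bounded_pos_meas g ->
  semigroup_op P s (EFin \o g) x \is a fin_num.
Proof.
move=> [mg g0 [M gM]].
rewrite ge0_fin_numE; last by apply: semigroup_ge0 => y; rewrite lee_fin.
apply: (@le_lt_trans _ _ M%:E); last exact: ltry.
have M0 : 0 <= M := le_trans (g0 point) (gM point).
rewrite -[leRHS](_ : (\int[P s x]_y (cst M%:E y))%E = _); last first.
  by rewrite integral_cst// [X in (_ * X)%E]prob_kernel mule1.
apply: ge0_le_integral => //.
- by move=> y _; rewrite lee_fin.
- exact/measurable_EFinP.
- by move=> y _; rewrite lee_fin.
Qed.

Lemma subordinated_fin t (g : borel E -> R) x : 0 <= t -> bounded_pos_meas g ->
  Pa t (EFin \o g) x \is a fin_num.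
Proof.
move=> t0 [mg g0 [M gM]].
rewrite ge0_fin_numE; last by apply: subordinated_ge0 => y; rewrite lee_fin.
apply: (@le_lt_trans _ _ M%:E); last exact: ltry.
have M0 : 0 <= M := le_trans (g0 point) (gM point).
rewrite -[leRHS](subordinated_cst P _ _ hm alpha0 t _ x)//.
apply: le_subordinated => //.
exact/measurable_EFinP.
Qed.

Lemma bounded_pos_meas_powR (f : borel E -> R) (p : R) : 0 <= p ->
  bounded_pos_meas f -> bounded_pos_meas (fun z => f z `^ p).
Proof.
move=> p0 [mf f0 [M fM]]; split.
- exact: (measurableT_comp (measurable_powR _)).
- by move=> z; exact: powR_ge0.
- exists (M `^ p) => z; apply: ge0_ler_powR; rewrite ?nnegrE//.
  exact: le_trans (f0 z) (fM z).
Qed.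

(** Take p-th roots of the Harnack inequality at time s, integrate in s with Hoelder's inequality
    for the weights (p-1)/p and 1/p, and raise the result to the power p. *)
Lemma subordinated_harnack_moment (kappa eps p t J : R) H x y
    (f : borel E -> R) :
  1 < p -> 0 < t -> 0 < J -> harnack kappa eps p H P -> bounded_pos_meas f ->
  (\int[m t]_(s in halfline) (expR (H x y / (p - 1) * s `^ (- kappa)))%:E
     <= J%:E)%E ->
  (Pa t (EFin \o f) x `^ p <=
   (expR (eps * H x y) * J `^ (p - 1))%:E * Pa t (fun z => (f z `^ p)%:E) y)%E.
Proof.
move=> p1 t0 J0 har bf mom; set h := H x y.
have p0 : 0 < p := lt_trans ltr01 p1.
have p10 : 0 < p - 1 by rewrite subr_gt0.
have [mf f0 _] := bf.
pose fp z := f z `^ p.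
have bfp : bounded_pos_meas fp := bounded_pos_meas_powR _ _ (ltW p0) bf.
have [mfp fp0 _] := bfp.
have ef0 z : (0 <= (EFin \o f) z)%E by rewrite lee_fin.
have efp0 z : (0 <= (EFin \o fp) z)%E by rewrite lee_fin.
have mef : measurable_fun [set: borel E] (EFin \o f) by exact/measurable_EFinP.
have mefp : measurable_fun [set: borel E] (EFin \o fp) by exact/measurable_EFinP.
pose a s := fine (semigroup_op P s (EFin \o f) x).
pose b s := fine (semigroup_op P s (EFin \o fp) y).
have aE s : semigroup_op P s (EFin \o f) x = (a s)%:E.
  by rewrite fineK// semigroup_fin.
have bE s : semigroup_op P s (EFin \o fp) y = (b s)%:E.
  by rewrite fineK// semigroup_fin.
have a0 s : 0 <= a s by rewrite -lee_fin -aE semigroup_ge0.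
have b0 s : 0 <= b s by rewrite -lee_fin -bE semigroup_ge0.
have ma : measurable_fun halfline (EFin \o a).
  apply: eq_measurable_fun (measurable_semigroup_time P hP _ x ef0 mef).
  by move=> s _; rewrite aE.
have mb : measurable_fun halfline (EFin \o b).
  apply: eq_measurable_fun (measurable_semigroup_time P hP _ y efp0 mefp).
  by move=> s _; rewrite bE.
set A := Pa t (EFin \o f) x; set B := Pa t _ y.
have AE : A = (\int[m t]_(s in halfline) (a s)%:E)%E.
  by apply: eq_integral => s _; exact: aE.
have BE : B = (\int[m t]_(s in halfline) (b s)%:E)%E.
  by apply: eq_integral => s _; exact: bE.
have Afin : A \is a fin_num by apply: subordinated_fin => //; exact: ltW.
have Bfin : B \is a fin_num by apply: (@subordinated_fin _ fp) => //; exact: ltW.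
have A0 : (0 <= A)%E by exact: subordinated_ge0.
have B0 : (0 <= B)%E by apply: subordinated_ge0 => z; exact: efp0.
pose theta := (p - 1) / p.
have th0 : 0 <= theta by rewrite divr_ge0 ?(ltW p10)// ltW.
have th1 : 1 - theta = p^-1 by rewrite /theta; field; rewrite gt_eqF.
have thle : theta <= 1 by rewrite -subr_ge0 th1 invr_ge0 ltW.
(* Chosen so that F^theta = exp(h s^(-kappa) / p), the time-dependent part of the p-th root of the
   Harnack factor. *)
pose F s := expR (h / (p - 1) * s `^ (- kappa)).
have mF : measurable_fun halfline F.
  apply: measurableT_comp => //; apply: measurable_funM => //.
  exact: (measurable_funTS (measurable_powR _)).
pose K := expR (eps * h / p).
have ptw s : 0 < s -> a s <= K * (F s `^ theta * b s `^ (1 - theta)).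
  move=> s0; have := har x y f s bf s0.
  rewrite aE (_ : semigroup_op _ _ _ y = (b s)%:E); last exact: bE.
  rewrite -EFinM lee_fin => le.
  have ap : a s = (a s `^ p) `^ p^-1 by rewrite -powRrM mulfV ?gt_eqF// powRr1.
  rewrite ap; apply: (le_trans (ge0_ler_powR _ _ _ le)).
  - by rewrite invr_ge0 ltW.
  - by rewrite nnegrE powR_ge0.
  - by rewrite nnegrE mulr_ge0// expR_ge0.
  rewrite powRM ?expR_ge0// th1 mulrA ler_wpM2r ?powR_ge0//.
  rewrite -!expRM -expRD ler_expR le_eqVlt; apply/orP; left; apply/eqP.
  by rewrite -/h /theta; field; rewrite !gt_eqF.
pose Q := expR (eps * h) * J `^ (p - 1).
have Q0 : 0 < Q by rewrite mulr_gt0 ?expR_gt0 ?powR_gt0.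
(* [hoelder_weighted] wants a positive bound while [B] may be 0; the slack is removed at the end by
   taking e / Q. *)
have main e : 0 < e -> fine A `^ p <= Q * (fine B + e).
  move=> e0; have Be0 : 0 < fine B + e by rewrite ltr_wpDl// fine_ge0.
  have hw := @hoelder_weighted _ _ R (m t) halfline F b theta J (fine B + e).
  have {}hw : (\int[m t]_(s in halfline) (F s `^ theta * b s `^ (1 - theta))%:E
      <= (J `^ theta * (fine B + e) `^ (1 - theta))%:E)%E.
    apply: hw => //.
    - exact/measurable_EFinP.
    - by move=> s _; rewrite expR_ge0.
    - by rewrite -BE -[leLHS](fineK Bfin) lee_fin lerDl ltW.
  have mG : measurable_fun halfline
      (fun s => (F s `^ theta * b s `^ (1 - theta))%:E).
    apply/measurable_EFinP; apply: measurable_funM.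
      exact: (measurableT_comp (measurable_powR _)).
    by apply: (measurableT_comp (measurable_powR _)); exact/measurable_EFinP.
  have AK : (A <= (K * (J `^ theta * (fine B + e) `^ (1 - theta)))%:E)%E.
    rewrite EFinM; apply: le_trans (lee_wpmul2l _ hw); last first.
      by rewrite lee_fin expR_ge0.
    rewrite -ge0_integralZl//; last 2 first.
    - by move=> s _; rewrite lee_fin mulr_ge0 ?powR_ge0.
    - by rewrite lee_fin expR_ge0.
    rewrite AE; apply: ae_ge0_le_integral => //.
    - by move=> s _; rewrite lee_fin.
    - by move=> s _; rewrite mule_ge0 ?lee_fin ?expR_ge0// mulr_ge0 ?powR_ge0.
    - exact: measurable_funeM.
    (* [ptw] is available at positive times; the remaining time 0 is a null set. *)
    exists [set 0]; split => //; first exact: (subordinator_no_atom0 _ _ hm alpha0 _ t0).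
    move=> s /= ns; apply: contrapT => s0; apply: ns.
    rewrite in_itv/= andbT => s_ge0; rewrite -EFinM lee_fin ptw//.
    by rewrite lt_neqAle s_ge0 andbT eq_sym; exact/eqP.
  have AK' : fine A <= K * (J `^ theta * (fine B + e) `^ (1 - theta)).
    by rewrite -lee_fin fineK.
  apply: (le_trans (ge0_ler_powR (ltW p0) _ _ AK')).
  - by rewrite nnegrE fine_ge0.
  - by rewrite nnegrE !mulr_ge0 ?expR_ge0 ?powR_ge0.
  rewrite !powRM ?mulr_ge0 ?expR_ge0 ?powR_ge0// -!powRrM -expRM th1.
  rewrite mulVf ?gt_eqF// (powRr1 (ltW Be0)) /theta !divfK ?gt_eqF//.
  by rewrite mulrA.
rewrite -(fineK Afin) -(fineK Bfin) poweR_EFin -EFinM lee_fin -/Q.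
apply/ler_addgt0Pr => e e0.
have := main (e / Q) (divr_gt0 e0 Q0).
by rewrite mulrDr (mulrC Q (e / Q)) divfK// gt_eqF.
Qed.

End subordinated_harnack.

(** * Integrals of weights with values in ]0, 1] *)

Section weight_integral.
Context d (T : measurableType d) (R : realType) (mu : probability T R)
  (w : T -> R).
Hypotheses (w0 : forall y, 0 < w y) (w1 : forall y, w y <= 1)
  (mw : measurable_fun [set: T] w).

Lemma weight_integralE :
  (\int[mu]_y (w y)%:E)%E = (fine (\int[mu]_y (w y)%:E))%:E.
Proof.
rewrite fineK// ge0_fin_numE; last first.
  by apply: integral_ge0 => y _; rewrite lee_fin ltW.
apply: (@le_lt_trans _ _ 1%E); last exact: ltry.
rewrite -[leRHS](_ : (\int[mu]_y (cst 1%E y))%E = _); last first.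
  by rewrite integral_cst// [X in (_ * X)%E]probability_setT mule1.
apply: ge0_le_integral => //.
- by move=> y _; rewrite lee_fin ltW.
- exact/measurable_EFinP.
- by move=> y _; rewrite lee_fin.
Qed.

(** A positive function with integral 0 would vanish almost everywhere, against mass 1. Hence the
    inverses in (i) and (ii) are inverses of positive reals. *)
Lemma weight_integral_gt0 : 0 < fine (\int[mu]_y (w y)%:E)%E.
Proof.
rewrite lt_neqAle -lee_fin -weight_integralE eq_sym.
apply/andP; split; last first.
  by apply: integral_ge0 => y _; rewrite lee_fin ltW.
apply/eqP => Phi0.
have : ae_eq mu [set: T] (fun y => (w y)%:E) (cst 0%E).
  have mew : measurable_fun [set: T] (fun y => (w y)%:E).
    exact/measurable_EFinP.
  apply/(ae_eq_integral_abs mu measurableT mew).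
  under eq_integral do rewrite gee0_abs ?lee_fin ?(ltW (w0 _))//.
  by rewrite weight_integralE Phi0.
move=> [N [mN N0 sN]].
have : mu [set: T] = 0%E.
  apply/eqP; rewrite -measure_le0 -N0 le_measure ?inE// => y _.
  by apply: sN => /= /(_ Logic.I) [] wy; have := w0 y; rewrite wy ltxx.
by rewrite probability_setT => /eqP; rewrite onee_eq0.
Qed.

End weight_integral.

(** * Integration against the invariant measure and the operator norm *)

Section integrated_harnack.
Context {R : realType} {E : polishType R}.
Variables (P : R -> R.-pker (borel E) ~> (borel E)) (alpha : R)
  (m : R -> probability R R).
Hypotheses (hP : markov_semigroup P) (hm : stable_subordinator alpha m)
  (alpha0 : 0 < alpha).
Local Notation Pa := (subordinated P m).
Variables (mu : probability (borel E) R) (p t : R)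
  (W : borel E -> borel E -> R).
Hypotheses (inv : invariant_measure P mu) (p1 : 1 < p) (t0 : 0 < t)
  (W0 : forall x y, 0 < W x y) (W1 : forall x y, W x y <= 1)
  (mW : forall x, measurable_fun [set: borel E] (W x)).
Hypothesis harW : forall x y (f : borel E -> R), bounded_pos_meas f ->
  (Pa t (EFin \o f) x `^ p * (W x y)%:E <=
   (2 `^ (p - 1))%:E * Pa t (fun z => (f z `^ p)%:E) y)%E.

Let p0 : 0 < p := lt_trans ltr01 p1.

Let Phi x := fine (\int[mu]_y (W x y)%:E)%E.

Let PhiE x : (\int[mu]_y (W x y)%:E)%E = (Phi x)%:E.
Proof. exact: weight_integralE. Qed.

Let Phi_gt0 x : 0 < Phi x.
Proof. exact: weight_integral_gt0. Qed.

Let meW x : measurable_fun [set: borel E] (fun y => (W x y)%:E).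
Proof. exact/measurable_EFinP. Qed.

(** Integrate [harW] in y: the power at x is constant, and invariance removes the semigroup on the
    right. *)
Lemma integrated_harnack x (f : borel E -> R) : bounded_pos_meas f ->
  (Pa t (EFin \o f) x `^ p * \int[mu]_y (W x y)%:E <=
   (2 `^ (p - 1))%:E * \int[mu]_y (f y `^ p)%:E)%E.
Proof.
move=> bf; have [mfp fp0 _] := bounded_pos_meas_powR _ _ (ltW p0) bf.
have mefp : measurable_fun [set: borel E] (fun z => (f z `^ p)%:E).
  exact/measurable_EFinP.
have efp0 z : (0 <= (f z `^ p)%:E)%E by rewrite lee_fin powR_ge0.
rewrite -(integral_subordinated P _ _ hP hm alpha0 mu t _ (ltW t0) inv efp0
  mefp).
have mPa := measurable_subordinated P m hP t _ efp0 mefp.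
rewrite -ge0_integralZl ?poweR_ge0//; last by move=> y _; rewrite lee_fin ltW.
rewrite -ge0_integralZl ?lee_fin ?powR_ge0//; last first.
  by move=> y _; exact: subordinated_ge0.
apply: ge0_le_integral => //.
- by move=> y _; rewrite mule_ge0 ?poweR_ge0// lee_fin ltW.
- exact: measurable_funeM.
- exact: measurable_funeM.
- by move=> y _; exact: harW.
Qed.

(** A pointwise bound uniform over the unit ball of L^p: truncations of |f| are bounded, so
    [integrated_harnack] applies to them, and its p-th root survives the limit. *)
Lemma subordinated_abs_le x (f : borel E -> R) :
  measurable_fun [set: borel E] f ->
  (\int[mu]_y (`|f y| `^ p)%:E <= 1)%E ->
  (Pa t (fun y => `|f y|%:E) x <=
   (2 `^ ((p - 1) / p) * (Phi x `^ p^-1)^-1)%:E)%E.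
Proof.
move=> mf f1; apply: (subordinated_truncated_le P m hP t (fun y => `|f y|)) => //.
  exact: measurableT_comp.
move=> n; pose g y := Num.min `|f y| n%:R.
have bg : bounded_pos_meas g.
  split; first by apply: measurable_minr => //; exact: measurableT_comp.
    by move=> y; rewrite le_min normr_ge0/=.
  by exists n%:R => y; rewrite ge_min lexx orbT.
have Pfin := subordinated_fin P _ _ hP hm alpha0 t g x (ltW t0) bg.
have P0 : (0 <= Pa t (EFin \o g) x)%E.
  by apply: subordinated_ge0 => y; have [_ g0 _] := bg; rewrite lee_fin.
have := integrated_harnack x g bg; rewrite PhiE.
have g1 : (\int[mu]_y (g y `^ p)%:E <= 1)%E.
  apply: le_trans f1; apply: ge0_le_integral_nonmeasurable => y.
    by rewrite lee_fin powR_ge0.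
  rewrite lee_fin; apply: ge0_ler_powR; rewrite ?nnegrE ?(ltW p0)//.
  - by rewrite le_min normr_ge0/=.
  - by rewrite ge_min lexx.
rewrite -[X in (X `^ p)%E](fineK Pfin) poweR_EFin -EFinM => le.
have {}le : fine (Pa t (EFin \o g) x) `^ p * Phi x <= 2 `^ (p - 1).
  rewrite -lee_fin (le_trans le)// -[leRHS]mule1 lee_wpmul2l// lee_fin powR_ge0//.
rewrite -[leLHS](fineK Pfin) lee_fin.
rewrite -[leLHS](_ : (fine (Pa t (EFin \o g) x) `^ p) `^ p^-1 = _); last first.
  by rewrite -powRrM mulfV ?gt_eqF// powRr1// fine_ge0.
have -> : 2 `^ ((p - 1) / p) * (Phi x `^ p^-1)^-1 =
    (2 `^ (p - 1) / Phi x) `^ p^-1.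
  rewrite powRM ?powR_ge0 ?invr_ge0 ?(ltW (Phi_gt0 x))// -powRrM; congr (_ * _).
  rewrite -[LHS]powR_inv1 ?powR_ge0// powRAC powR_inv1 ?(ltW (Phi_gt0 x))//.
apply: ge0_ler_powR; rewrite ?nnegrE ?powR_ge0// ?invr_ge0 ?(ltW p0)//.
  by rewrite mulr_ge0 ?powR_ge0// invr_ge0 ltW.
by rewrite ler_pdivlMr.
Qed.

(** Take the L^q norm in x of the bound in [subordinated_abs_le]; signed f are covered by |P f| <= P
    |f|. *)
Lemma Lpq_norm_subordinated_le (q : R) : 1 < q ->
  (Lpq_norm mu p q (Pa t) / (2 `^ ((p - 1) / p))%:E <=
   (\int[mu]_x ((\int[mu]_y (W x y)%:E) `^ (q / p))^-1) `^ (1 / q))%E.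
Proof.
move=> q1; have q0 : 0 < q := lt_trans ltr01 q1.
set k := 2 `^ ((p - 1) / p); have k0 : 0 < k by exact: powR_gt0.
set I := (\int[mu]_x _)%E.
have GE x : (((\int[mu]_y (W x y)%:E) `^ (q / p))^-1 =
    ((Phi x `^ (q / p))^-1)%:E)%E.
  by rewrite PhiE poweR_EFin inver gt_eqF// powR_gt0.
have I0 : (0 <= I)%E.
  by apply: integral_ge0 => x _; rewrite GE lee_fin invr_ge0 powR_ge0.
rewrite inver gt_eqF// -lee_pdivlMr ?invr_gt0// invrK.
apply: ge_ereal_sup => _ [f [fL f1] <-].
have mf : measurable_fun [set: borel E] f.
  by have := sub_Lfun_mfun fL; rewrite inE.
have {}f1 : (\int[mu]_y (`|f y| `^ p)%:E <= 1)%E.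
  have <- : ('N[mu]_p%:E [EFin \o f] `^ p = \int[mu]_y (`|f y| `^ p)%:E)%E.
    by rewrite poweR_Lnorm ?gt_eqF.
  rewrite -[leRHS](poweR1r p); apply: gt0_ler_poweR => //.
  - exact: ltW.
  - by rewrite in_itv/= Lnorm_ge0 leey.
  - by rewrite in_itv/= lee01 leey.
have kq0 : 0 < k `^ q := powR_gt0 _ k0.
have PaF x : (`|Pa t (EFin \o f) x| <= (k * (Phi x `^ p^-1)^-1)%:E)%E.
  apply: le_trans (abse_subordinated_le P m hP t f x mf) _.
  exact: subordinated_abs_le.
have mabs : measurable_fun [set: borel E] (fun y => `|f y|%:E).
  by apply/measurable_EFinP; exact: measurableT_comp.
have PaI : (\int[mu]_x (`|Pa t (EFin \o f) x| `^ q) <= (k `^ q)%:E * I)%E.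
  pose G x := (Pa t (fun y => `|f y|%:E) x `^ q)%E.
  have mG : measurable_fun [set: borel E] G.
    apply: (measurableT_comp (measurable_poweR _)).
    exact: measurable_subordinated.
  have G0 x : (0 <= G x)%E by exact: poweR_ge0.
  apply: (@le_trans _ _ (\int[mu]_x G x)%E).
    apply: ge0_le_integral_nonmeasurable => x; first exact: poweR_ge0.
    apply: gt0_ler_poweR; rewrite ?in_itv/= ?leey ?andbT ?(ltW q0)//.
      exact: subordinated_ge0.
    exact: abse_subordinated_le.
  (* The constant is moved to the side of [G], whose measurability lets it enter the integral. *)
  rewrite -lee_pdivrMl//.
  rewrite -ge0_integralZl ?lee_fin ?invr_ge0 ?(ltW kq0)//.
  apply: ge0_le_integral_nonmeasurable => x.
    by rewrite mule_ge0// lee_fin invr_ge0 ltW.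
  rewrite lee_pdivrMl// GE -EFinM.
  rewrite (_ : k `^ q * _ = (k * (Phi x `^ p^-1)^-1) `^ q); last first.
    rewrite powRM ?(ltW k0) ?invr_ge0 ?powR_ge0//; congr (_ * _).
    rewrite -[in RHS]powR_inv1 ?powR_ge0// powRAC powR_inv1 ?powR_ge0//.
    by rewrite -powRrM mulrC.
  rewrite -poweR_EFin.
  apply: gt0_ler_poweR; rewrite ?in_itv/= ?leey ?andbT ?(ltW q0)//.
  - exact: subordinated_ge0.
  - by rewrite lee_fin mulr_ge0 ?(ltW k0)// invr_ge0 powR_ge0.
  - exact: subordinated_abs_le.
rewrite unlock.
apply: (@le_trans _ _ (((k `^ q)%:E * I) `^ (1 / q))%E).
  rewrite div1r; apply: gt0_ler_poweR => //.
  - by rewrite invr_ge0 ltW.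
  - by rewrite in_itv/= leey andbT integral_ge0// => x _; exact: poweR_ge0.
  - by rewrite in_itv/= leey andbT mule_ge0// lee_fin ltW.
rewrite poweRM ?lee_fin ?(ltW kq0)// poweR_EFin -powRrM div1r mulfV ?gt_eqF//.
by rewrite powRr1 ?(ltW k0)// muleC.
Qed.

End integrated_harnack.

(** * The L^2 bound for the transition density *)

Section density_bound.
Context {R : realType} {E : polishType R}.
Variables (P : R -> R.-pker (borel E) ~> (borel E)) (alpha : R)
  (m : R -> probability R R).
Hypotheses (hP : markov_semigroup P) (hm : stable_subordinator alpha m)
  (alpha0 : 0 < alpha).
Local Notation Pa := (subordinated P m).
Variables (mu : probability (borel E) R) (t : R) (t0 : 0 < t)
  (d : borel E -> borel E -> R).
Hypothesis hd : transition_density mu (Pa t) d.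

Let md x : measurable_fun [set: borel E] (d x) := hd.1 x.

(* The density is a version of its positive part: testing on [set y | d x y < 0]
   shows that this set is negligible. *)
Let dp x y : R := Num.max (d x y) 0.

Let mdp x : measurable_fun [set: borel E] (dp x).
Proof. exact: measurable_maxr. Qed.

Let dp0 x y : 0 <= dp x y. Proof. by rewrite le_max lexx orbT. Qed.

Let dpE x : \forall y \ae mu, dp x y = d x y.
Proof.
pose A := [set y | d x y < 0].
have mA : measurable A.
  have := @measurable_fun_ltr _ _ _ setT (d x) (cst 0) (md x)
    (@measurable_cst _ _ _ _ _ _).
  by move=> /(_ measurableT [set true]); rewrite setTI; apply.
pose n y : R := - (d x y * \1_A y).
have n0 y : 0 <= n y.
  rewrite /n indicE; have [|] := boolP (y \in A); last by rewrite mulr0 oppr0.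
  by rewrite inE /A/= mulr1 oppr_ge0 => /ltW.
have mn : measurable_fun [set: borel E] (EFin \o n).
  apply/measurable_EFinP; apply: measurableT_comp => //.
  by apply: measurable_funM => //; exact: measurable_indic.
have bA : bounded_pos_meas (\1_A : borel E -> R).
  split; [exact: measurable_indic|by move=> y; rewrite indicE|].
  by exists 1 => y; rewrite indicE lern1 leq_b1.
have intn0 : (\int[mu]_y (n y)%:E = 0)%E.
  apply/eqP; rewrite eq_le integral_ge0 ?andbT//; last first.
    by move=> y _; rewrite lee_fin.
  have := subordinated_ge0 P m t (EFin \o \1_A) x.
  rewrite (hd.2 _ x bA) => /(_ _)H.
  rewrite -oppe_ge0 -integral_ge0N; last by move=> y _; rewrite lee_fin.
  under eq_integral do rewrite -EFinN /n opprK.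
  by apply: H => y; rewrite lee_fin indicE.
have : ae_eq mu [set: borel E] (EFin \o n) (cst 0%E).
  apply/(ae_eq_integral_abs mu measurableT mn).
  by under eq_integral do rewrite /= ger0_norm//.
apply: filterS => y /= /(_ Logic.I) [] /eqP.
rewrite /n oppr_eq0 indicE; have [yA|yA] := boolP (y \in A).
  by rewrite mulr1 => /eqP d0; rewrite /dp d0 max_l.
move=> _; rewrite /dp max_l// leNgt; apply: contra yA.
by rewrite inE.
Qed.

Let dp_op x (f : borel E -> R) : bounded_pos_meas f ->
  (Pa t (EFin \o f) x = \int[mu]_y (dp x y * f y)%:E)%E.
Proof.
move=> bf; have [mf _ _] := bf; rewrite (hd.2 _ x bf).
apply: ae_eq_integral => //.
- by apply/measurable_EFinP; exact: measurable_funM.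
- by apply/measurable_EFinP; exact: measurable_funM.
- by have := dpE x; apply: filterS => y dy _; rewrite dy.
Qed.

(** The density is paired with its own truncations: the integrals of [dp x y * g n y] increase to
    the integral of the square, so a bound uniform in n suffices. *)
Lemma density_bound (p Phi : R) x : 1 < p -> p <= 2 -> 0 < Phi ->
  (forall f, bounded_pos_meas f ->
    (Pa t (EFin \o f) x `^ p * Phi%:E <=
     (2 `^ (p - 1))%:E * \int[mu]_y (f y `^ p)%:E)%E) ->
  (\int[mu]_y ((d x y) ^+ 2)%:E <= 2%:E * Phi%:E^-1)%E.
Proof.
move=> p1 p2 Phi0 harn; have p0 : 0 < p := lt_trans ltr01 p1.
rewrite inver gt_eqF// -EFinM.
have -> : (\int[mu]_y ((d x y) ^+ 2)%:E = \int[mu]_y ((dp x y) ^+ 2)%:E)%E.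
  apply: ae_eq_integral => //.
  - by apply/measurable_EFinP; exact: measurable_funX.
  - by apply/measurable_EFinP; exact: measurable_funX.
  - by have := dpE x; apply: filterS => y dy _; rewrite dy.
pose g n y := Num.min (dp x y) n%:R.
have g0 n y : 0 <= g n y by rewrite le_min dp0/=.
have gd n y : g n y <= dp x y by rewrite ge_min lexx.
have mg n : measurable_fun [set: borel E] (g n) by exact: measurable_minr.
have bg n : bounded_pos_meas (g n).
  by split => //; exists n%:R => y; rewrite ge_min lexx orbT.
have mdg n : measurable_fun [set: borel E] (fun y => (dp x y * g n y)%:E).
  by apply/measurable_EFinP; exact: measurable_funM.
have gmono n k y : (n <= k)%N -> g n y <= g k y.
  move=> nk; rewrite le_min ge_min lexx/= ge_min.
  by apply/orP; right; rewrite ler_nat.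
(* The subordinated semigroup preserves constants; this is the L^1 bound for the interpolation
   below. *)
have dp1 : (\int[mu]_y (dp x y)%:E = 1)%E.
  have b1 : bounded_pos_meas (cst 1 : borel E -> R).
    by split => //; exists 1.
  have := dp_op x _ b1.
  rewrite (subordinated_cst P _ _ hm alpha0 t 1 x (ltW t0) ler01).
  by under eq_integral do rewrite /= mulr1.
have bnd n : (\int[mu]_y (dp x y * g n y)%:E <= (2 * Phi^-1)%:E)%E.
  have Ifin := subordinated_fin P _ _ hP hm alpha0 t _ x (ltW t0) (bg n).
  have := harn _ (bg n); rewrite -(dp_op x _ (bg n)).
  set I := Pa t _ x in Ifin *.
  have I_ge0 : (0 <= I)%E by apply: subordinated_ge0 => y; rewrite lee_fin.
  (* The argument divides by I^(p-1), so I = 0 is treated apart. *)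
  have [I0|I0] := eqVneq (fine I) 0.
    by move=> _; rewrite -(fineK Ifin) I0 lee_fin mulr_ge0// invr_ge0 ltW.
  have {I0}I_gt0 : 0 < fine I by rewrite lt_neqAle eq_sym I0 fine_ge0.
  rewrite -(fineK Ifin) poweR_EFin -EFinM lee_fin => le.
  have gp : (\int[mu]_y (g n y `^ p)%:E <= (fine I `^ (p - 1))%:E)%E.
    (* Testing with g = g n and I = P_t^alpha g(x), interpolation of L^p between
       L^1 and L^2 gives I^p Phi <= 2^(p-1) I^(p-1); this is where p <= 2. *)
    have -> : (\int[mu]_y (g n y `^ p)%:E =
        \int[mu]_y (g n y `^ (2 - p) * (g n y * g n y) `^ (1 - (2 - p)))%:E)%E.
      apply: eq_integral => y _; congr (_%:E).
      (* At p = 2 the factor with exponent 2 - p is 1 even at 0, so the second factor must supply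
         the zero. *)
      have [->|gn0] := eqVneq (g n y) 0.
        rewrite mul0r [0 `^ p]powR0 ?gt_eqF//.
        by rewrite [0 `^ (1 - _)]powR0 ?mulr0// gt_eqF//; lra.
      rewrite powRM// -!powRD ?gn0 ?implybT//; congr (_ `^ _); ring.
    have hw := @hoelder_weighted _ _ R mu [set: borel E] (g n)
      (fun y => g n y * g n y) (2 - p) 1 (fine I).
    have := hw measurableT (mg n) (measurable_funM (mg n) (mg n)).
    rewrite powR1 mul1r (_ : 1 - (2 - p) = p - 1); last by ring.
    apply => //.
    - by move=> y _; exact: mulr_ge0.
    - lra.
    - lra.
    - rewrite -dp1; apply: ge0_le_integral => //.
      + by move=> y _; rewrite lee_fin.
      + exact/measurable_EFinP.
      + exact/measurable_EFinP.
      + by move=> y _; rewrite lee_fin.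
    - rewrite fineK// /I dp_op//; apply: ge0_le_integral => //.
      + by move=> y _; rewrite lee_fin mulr_ge0.
      + by apply/measurable_EFinP; exact: measurable_funM.
      + by move=> y _; rewrite lee_fin ler_wpM2r.
  rewrite ler_pdivlMr//.
  have Ip1 : 0 < fine I `^ (p - 1) by exact: powR_gt0.
  have {}le : fine I `^ p * Phi <= 2 `^ (p - 1) * fine I `^ (p - 1).
    by rewrite -lee_fin (le_trans le)// EFinM lee_wpmul2l// lee_fin powR_ge0.
  apply: (@le_trans _ _ (2 `^ (p - 1))).
    by rewrite -(ler_pM2r Ip1) mulrAC mulr_powRB1// ltW.
  by rewrite -[leRHS]powRr1// ler_powR ?ler1n//; lra.
pose h n y := (dp x y * g n y)%:E : \bar R.
have h0 n y : (0 <= h n y)%E by rewrite lee_fin mulr_ge0.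
have hmono n k y : (n <= k)%N -> (h n y <= h k y)%E.
  by move=> nk; rewrite lee_fin ler_wpM2l// gmono.
have -> : (\int[mu]_y (dp x y ^+ 2)%:E = limn (fun n => \int[mu]_y h n y))%E.
  rewrite -monotone_convergence//; last by move=> y _ n k nk; exact: hmono.
  apply: eq_integral => y _; apply/esym; apply: lim_near_cst => //.
  exists (Num.truncn (dp x y)).+1 => // n /= yn.
  rewrite /h /g min_l//; apply: le_trans (ltW (truncnS_gt _)) _.
  by rewrite ler_nat.
apply: lime_le; last by apply: nearW => n; exact: bnd.
apply: ereal_nondecreasing_is_cvgn => n k nk.
apply: ge0_le_integral => //; [exact: mdg|exact: mdg|].
by move=> y _; exact: hmono.
Qed.

End density_bound.

(** * Comparison of the two Harnack factors *)

Section stable_harnack_weight.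
Context {R : realType}.
Variables (kappa alpha c p : R).
Hypotheses (kappa0 : 0 < kappa) (alphak : kappa / (kappa + 1) < alpha)
  (al1 : alpha < 1) (c0 : 0 < c) (p1 : 1 < p).
Local Notation r := (Hexp kappa alpha).

Lemma Cpka_ge0 : 0 <= Cpka c p kappa alpha.
Proof.
by rewrite /Cpka divr_ge0 ?powR_ge0// mulr_ge0 ?powR_ge0// ltW// Hexp_gt0.
Qed.

(* (1 + (e^u - 1)^r)^(p-1) <= (2 e^(r u))^(p-1), and C_(p,kappa,alpha) is
   designed so that (p - 1) r u equals the exponent on the right. *)
Lemma harnack_factor_le (h T : R) : 0 <= h -> 0 < T ->
  (1 + (expR ((c * h / ((p - 1) * T)) `^ (1 / r)) - 1) `^ r) `^ (p - 1) <=
  2 `^ (p - 1) * expR (Cpka c p kappa alpha * (h / T) `^ (1 / r)).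
Proof.
move=> h0 T0; have r0 : 0 < r := Hexp_gt0 alpha kappa kappa0 alphak.
have p10 : 0 < p - 1 by rewrite subr_gt0.
have hT0 : 0 <= h / T by rewrite divr_ge0// ltW.
set u := (c * h / ((p - 1) * T)) `^ (1 / r).
have u0 : 0 <= u := powR_ge0 _ _.
have uE : Cpka c p kappa alpha * (h / T) `^ (1 / r) = r * u * (p - 1).
  rewrite /u (_ : c * h / _ = c * (p - 1)^-1 * (h / T)); last first.
    by field; rewrite !gt_eqF.
  have cp0 : 0 <= c * (p - 1)^-1 by rewrite mulr_ge0 ?invr_ge0 ?ltW.
  rewrite (powRM _ cp0 hT0) (@powRM _ c) ?invr_ge0 ?(ltW c0) ?(ltW p10)//.
  have -> : (p - 1)^-1 `^ (1 / r) = ((p - 1) `^ (1 / r))^-1.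
    by rewrite -powR_inv1 ?(ltW p10)// powRAC powR_inv1 ?powR_ge0.
  rewrite /Cpka.
  (* The denominator of the constant becomes (p-1)^(1/r) / (p-1), which leaves the factor p - 1 next
     to r u. *)
  have -> : (alpha^-1 - 1) * kappa / r = 1 / r - 1.
    rewrite (_ : (alpha^-1 - 1) * kappa = 1 - r); last by rewrite /Hexp; ring.
    by rewrite mulrBl divff// gt_eqF.
  rewrite powRB; last by rewrite (gt_eqF p10) implybT.
  rewrite powRr1 ?(ltW p10)//.
  field; rewrite (gt_eqF p10) gt_eqF ?powR_gt0//.
rewrite uE expRM -powRM ?expR_ge0//; apply: ge0_ler_powR.
- exact: ltW.
- by rewrite nnegrE addr_ge0// powR_ge0.
- by rewrite nnegrE mulr_ge0// expR_ge0.
rewrite (_ : 2 * _ = expR (r * u) + expR (r * u)); last first.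
  by rewrite mulr_natl mulr2n.
apply: lerD; first by rewrite -expR0 ler_expR mulr_ge0// ltW.
rewrite mulrC expRM; apply: ge0_ler_powR; rewrite ?nnegrE ?expR_ge0 ?(ltW r0)//.
- by rewrite subr_ge0 -expR0 ler_expR.
- by rewrite gerDl oppr_le0.
Qed.

End stable_harnack_weight.

(** * Assembly of the Harnack inequality, the norm bound and the density bound *)

Theorem theorem1p1 (R : realType) (kappa alpha : R) :
  0 < kappa -> kappa / (kappa + 1) < alpha -> alpha < 1 ->
  exists2 c : R, 0 < c &
  forall (E : polishType R) (P : R -> R.-pker (borel E) ~> (borel E))
    (m : R -> probability R R) (p eps : R) (H : borel E -> borel E -> R),
  markov_semigroup P -> stable_subordinator alpha m ->
  1 < p -> 0 <= eps ->
  (forall x y, 0 <= H x y) ->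
  measurable_fun setT (fun z : borel E * borel E => H z.1 z.2) ->
  harnack kappa eps p H P ->
  let r := Hexp kappa alpha in
  let C := Cpka c p kappa alpha in
  let Pa := subordinated P m in
  (forall (t : R) (x y : borel E) (f : borel E -> R),
    0 < t -> bounded_pos_meas f ->
    (Pa t (EFin \o f) x `^ p <=
     (expR (eps * H x y) *
      (1 + (expR ((c * H x y / ((p - 1) * t `^ (kappa / alpha))) `^ (1 / r))
            - 1) `^ r) `^ (p - 1))%:E *
     Pa t (fun z => (f z `^ p)%:E) y)%E /\
    ((expR (eps * H x y) *
      (1 + (expR ((c * H x y / ((p - 1) * t `^ (kappa / alpha))) `^ (1 / r))
            - 1) `^ r) `^ (p - 1))%:E *
     Pa t (fun z => (f z `^ p)%:E) y <=
     (2 `^ (p - 1) *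
      expR (eps * H x y + C * (H x y / t `^ (kappa / alpha)) `^ (1 / r)))%:E *
     Pa t (fun z => (f z `^ p)%:E) y)%E) /\
  (forall mu : probability (borel E) R, invariant_measure P mu ->
    forall t : R, 0 < t ->
    (forall q : R, 1 < q ->
      (Lpq_norm mu p q (Pa t) / (2 `^ ((p - 1) / p))%:E <=
       (\int[mu]_x
          ((\int[mu]_y (expR (- (eps * H x y)
              - C * (H x y / t `^ (kappa / alpha)) `^ (1 / r)))%:E)
            `^ (q / p))^-1) `^ (1 / q))%E) /\
    (p <= 2 ->
      forall d : borel E -> borel E -> R, transition_density mu (Pa t) d ->
      forall x : E, x \in measure_supp mu ->
      (\int[mu]_y ((d x y) ^+ 2)%:E <=
       2%:E * (\int[mu]_y (expR (- (eps * H x y)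
              - C * (H x y / t `^ (kappa / alpha)) `^ (1 / r)))%:E)^-1)%E)).
Proof.
move=> kappa0 alphak al1.
have alpha0 : 0 < alpha by apply: lt_trans alphak; rewrite divr_gt0// addr_gt0.
have [c c0 mom] := stable_inverse_moment alpha kappa kappa0 alphak al1.
exists c => // E P m p eps H hP hm p1 eps0 H0 mH har r C Pa.
have p10 : 0 < p - 1 by rewrite subr_gt0.
have C0 : 0 <= C by exact: Cpka_ge0.
have bnd1 t x y f : 0 < t -> bounded_pos_meas f ->
    (Pa t (EFin \o f) x `^ p <=
     (expR (eps * H x y) *
      (1 + (expR ((c * H x y / ((p - 1) * t `^ (kappa / alpha))) `^ (1 / r))
            - 1) `^ r) `^ (p - 1))%:E *
     Pa t (fun z => (f z `^ p)%:E) y)%E.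
  move=> t0 bf.
  apply: (subordinated_harnack_moment P _ _ hP hm alpha0 kappa) => //.
    by rewrite ltr_wpDr// powR_ge0.
  (* The moment bound is used with lambda = H(x,y)/(p-1). *)
  rewrite (_ : c * H x y / _ = c * (H x y / (p - 1)) / t `^ (kappa / alpha)).
    apply: mom => //; first by rewrite divr_ge0// ltW.
    by move=> z z0; rewrite (subordinator_laplace _ _ hm)// ltW.
  by field; rewrite !gt_eqF// powR_gt0.
have bnd2 t x y f : 0 < t -> bounded_pos_meas f ->
    ((expR (eps * H x y) *
      (1 + (expR ((c * H x y / ((p - 1) * t `^ (kappa / alpha))) `^ (1 / r))
            - 1) `^ r) `^ (p - 1))%:E *
     Pa t (fun z => (f z `^ p)%:E) y <=
     (2 `^ (p - 1) *
      expR (eps * H x y + C * (H x y / t `^ (kappa / alpha)) `^ (1 / r)))%:E *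
     Pa t (fun z => (f z `^ p)%:E) y)%E.
  move=> t0 bf; apply: lee_wpmul2r.
    by apply: subordinated_ge0 => z; rewrite lee_fin powR_ge0.
  rewrite lee_fin expRD mulrCA ler_wpM2l ?expR_ge0//.
  by apply: harnack_factor_le => //; exact: powR_gt0.
split; first by move=> t x y f t0 bf; split; [exact: bnd1|exact: bnd2].
move=> mu inv t t0.
(* The inverse of the exponential Harnack factor: moved to the left-hand side it is bounded by 1,
   hence integrable in y. *)
pose W x y :=
  expR (- (eps * H x y) - C * (H x y / t `^ (kappa / alpha)) `^ (1 / r)).
have W0 x y : 0 < W x y by exact: expR_gt0.
have W1 x y : W x y <= 1.
  rewrite -expR0 ler_expR -opprD oppr_le0 addr_ge0// mulr_ge0//.
  exact: powR_ge0.
have mW x : measurable_fun [set: borel E] (W x).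
  have mHx : measurable_fun [set: borel E] (H x).
    exact: (@measurable_fun_pair2 _ _ _ _ _ _ _ x mH).
  apply: measurableT_comp => //; apply: measurable_funB.
    by apply: measurableT_comp => //; exact: measurable_funM.
  apply: measurable_funM => //; apply: (measurableT_comp (measurable_powR _)).
  exact: measurable_funM.
have harW x y (f : borel E -> R) : bounded_pos_meas f ->
    (Pa t (EFin \o f) x `^ p * (W x y)%:E <=
     (2 `^ (p - 1))%:E * Pa t (fun z => (f z `^ p)%:E) y)%E.
  move=> bf; have := le_trans (bnd1 t x y f t0 bf) (bnd2 t x y f t0 bf).
  have Wp : (0 <= (W x y)%:E)%E by rewrite lee_fin ltW.
  move=> /(lee_wpmul2r Wp) /le_trans; apply.
  rewrite muleAC -EFinM -mulrA /W -expRD.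
  by rewrite [X in expR X](_ : _ = 0) ?expR0 ?mulr1//; ring.
split.
  move=> q q1.
  exact: (Lpq_norm_subordinated_le P _ m hP hm alpha0 mu p t W inv p1 t0 W0 W1
    mW harW).
move=> p2 d hd x _.
have PhiE := weight_integralE _ _ _ mu (W x) (W0 x) (W1 x) (mW x).
have Phi0 := weight_integral_gt0 _ _ _ mu (W x) (W0 x) (W1 x) (mW x).
change (\int[mu]_y ((d x y) ^+ 2)%:E <= 2%:E * (\int[mu]_y (W x y)%:E)^-1)%E.
rewrite PhiE; apply: (density_bound P _ m hP hm alpha0 mu t t0 d hd p) => //.
move=> f bf; rewrite -PhiE.
exact: (integrated_harnack P _ m hP hm alpha0 mu p t W inv p1 t0 W0 mW harW).
Qed.
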